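(* Let $0<\epsilon\le 0.2$ and $0<\delta\le 0.05$, and let $1\le k\le m$ be an integer. Consider the oneshot differentially private spectral method with noise scale $\lambda$, applied to $\rho$-constrained comparison graphs on $[m]$ with $L$ comparisons per edge and normalization factor $d>0$. If $$\lambda\ \ge\ \frac{8 s\sqrt{k\log(m/\delta)}}{\epsilon},\qquad\text{where } s=\frac{2}{dL(1-\rho)},$$ then the method is $(\epsilon,\delta)$-differentially private.
   Context: Data: a graph $\mathcal{G}=([m],E)$ on vertex set $[m]=\{1,\dots,m\}$, and for each edge $(i,j)\in E$ and each $1\le l\le L$ a comparison outcome $y^{(l)}_{i,j}\in\{0,1\}$ with $y^{(l)}_{j,i}=1-y^{(l)}_{i,j}$. Set $y_{i,j}=\frac1L\sum_{l=1}^L y^{(l)}_{i,j}$. Two datasets (comparison graphs) are adjacent if they have the same edge set and differ in only one data item, i.e. in the outcome of a single sample $l$ of a single edge (that is, in $y^{(l)}_{i,j}$ and correspondingly $y^{(l)}_{j,i}=1-y^{(l)}_{i,j}$). Transition matrix: for a given normalization factor $d>0$ (the same for all datasets, of the order of the maximum vertex degree, so that the matrix below is stochastic), $\boldsymbol{P}=[P_{ij}]_{m\times m}$ is defined by $P_{ij}=\frac1d y_{i,j}$ if $(i,j)\in E$, $P_{ii}=1-\frac1d\sum_{k:(i,k)\in E}y_{i,k}$, and $P_{ij}=0$ otherwise. Ergodicity coefficient: for a stochastic matrix $\boldsymbol{A}$, $\tau_1(\boldsymbol{A})=\sup\{\|\boldsymbol{v}^\top\boldsymbol{A}\|_1:\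 \|\boldsymbol{v}\|_1=1,\ \boldsymbol{v}^\top e=0\}$, with $e$ the all-ones vector. $\rho$-constrained: for a fixed constant $\rho<1$, a comparison graph (with its data) is $\rho$-constrained if the Markov chain with transition matrix $\boldsymbol{P}$ has a unique stationary distribution and $\tau_1(\boldsymbol{P})\le\rho$. Oneshot differentially private spectral method with noise scale $\lambda>0$: given a $\rho$-constrained comparison graph with its data, form $\boldsymbol{P}$, compute its stationary distribution $\boldsymbol{\pi}=(\pi_1,\dots,\pi_m)$, draw $g_1,\dots,g_m$ i.i.d. from the Laplace distribution $\mathrm{Lap}(\lambda)$ (density $\frac1{2\lambda}e^{-|z|/\lambda}$), and return the unordered set of indices of the $k$ smallest values among $-\pi_1+g_1,\dots,-\pi_m+g_m$ (ties occur with probability zero). Differential privacy: a randomized mechanism $\mathcal{M}$ is $(\epsilon,\delta)$-differentially private if for all adjacent inputs $D,D'$ (both in the admissible class of inputs, here $\rho$-constrained comparison graphs) and every set $S$ of possible outputs, $\mathbb{P}(\mathcal{M}(D)\in S)\le e^{\epsilon}\,\mathbb{P}(\mathcal{M}(D')\in S)+\delta$. $\log$ is the natural logarithm. *)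

(* Defs.v *)
From HB Require Import structures.
From mathcomp Require Import all_boot all_order all_algebra.
From mathcomp Require Import all_classical all_reals all_analysis.

Set Implicit Arguments.
Unset Strict Implicit.
Unset Printing Implicit Defensive.

Import Order.TTheory GRing.Theory Num.Theory.
Import numFieldNormedType.Exports.

Local Open Scope classical_set_scope.
Local Open Scope ring_scope.

(* [outcome l i j] is a total function, but only its values on edges are data;
   everything below ignores the values off the edge set. *)
Record comparison_graph (m L : nat) := ComparisonGraph {
  edge : rel 'I_m;
  edge_sym : symmetric edge;
  edge_irr : irreflexive edge;
  outcome : 'I_L -> 'I_m -> 'I_m -> bool;
  outcomeC : forall l i j, edge i j -> outcome l j i = ~~ outcome l i j }.

(* The two orientations (l, i, j) and (l, j, i) are one data item, whence the
   unordered pairs. *)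
Definition adjacent_data (m L : nat) (D D' : comparison_graph m L) : Prop :=
  edge D =2 edge D' /\
  exists l i j, [/\ edge D i j,
    outcome D l i j != outcome D' l i j &
    forall l' a b, edge D a b ->
      (l', [set a; b]%SET) != (l, [set i; j]%SET) ->
      outcome D l' a b = outcome D' l' a b].

Section spectral.
Context {R : realType} {m L : nat}.
Implicit Types (A : 'M[R]_m) (v p : 'rV[R]_m) (D : comparison_graph m L).

Definition mean_outcome D (i j : 'I_m) : R :=
  L%:R^-1 * \sum_(l < L) (outcome D l i j)%:R.

Definition transition_mx (d : R) D : 'M[R]_m :=
  \matrix_(i, j)
    if i == j then 1 - d^-1 * \sum_(k | edge D i k) mean_outcome D i k
    else if edge D i j then d^-1 * mean_outcome D i j
    else 0.

Definition stochastic_mx A : Prop :=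
  (forall i j, 0 <= A i j) /\ (forall i, \sum_j A i j = 1).

Definition stationary A p : Prop :=
  [/\ forall i, 0 <= p 0 i, \sum_i p 0 i = 1 & p *m A = p].

Definition norm1 v : R := \sum_i `|v 0 i|.

(* For m <= 1 the set is empty and its [sup] is 0. *)
Definition ergodicity_coef A : R :=
  sup [set norm1 (v *m A) | v in [set v | norm1 v = 1 /\ \sum_i v 0 i = 0]].

Definition rho_constrained (d rho : R) D : Prop :=
  let A := transition_mx d D in
  [/\ stochastic_mx A, (exists! p, stationary A p) & ergodicity_coef A <= rho].

(* The default value 0 is irrelevant on rho-constrained graphs. *)
Definition stationary_distribution A : 'rV[R]_m := xget 0 (stationary A).

(* [sort] is stable, so ties are broken in favour of the smaller index. *)
Definition k_smallest (k : nat) (x : 'I_m -> R) : {set 'I_m} :=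
  [set:: take k (sort (fun i j => x i <= x j) (enum 'I_m))]%SET.

Definition oneshot_spectral (T : Type) (d : R) (k : nat) (g : 'I_m -> T -> R)
    D (w : T) : {set 'I_m} :=
  let p := stationary_distribution (transition_mx d D) in
  k_smallest k (fun i => - p 0 i + g i w).

End spectral.

Section probability.
Context {R : realType} {disp : measure_display} {T : measurableType disp}.
Variable P : probability T R.

Definition mutually_independent (I : finType) (X : I -> {RV P >-> R}) : Prop :=
  forall (J : {set I}) (A : I -> set R), (forall i, measurable (A i)) ->
    P (\bigcap_(i in [set` J]) (X i @^-1` A i)) =
    (\prod_(i in J) P (X i @^-1` A i))%E.

Definition laplace_pdf (b x : R) : R := (2 * b)^-1 * expR (- `|x| / b).

Definition laplace_distributed (b : R) (X : {RV P >-> R}) : Prop :=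
  forall A : set R, measurable A ->
    distribution P X A = (\int[lebesgue_measure]_(x in A) (laplace_pdf b x)%:E)%E.

Definition differentially_private (I O : Type) (admissible : set I)
    (adj : I -> I -> Prop) (M : I -> T -> O) (eps delta : R) : Prop :=
  forall D D', admissible D -> admissible D' -> adj D D' ->
  forall S : set O,
    (P (M D @^-1` S) <= (expR eps)%:E * P (M D' @^-1` S) + delta%:E)%E.

End probability.

(* Main.v *)
Require Import Defs.
From HB Require Import structures.
From mathcomp Require Import all_boot all_order all_algebra.
From mathcomp Require Import all_classical all_reals all_analysis measurable_realfun.
From mathcomp Require Import lra.

Import Order.TTheory GRing.Theory Num.Theory.
Import numFieldNormedType.Exports.

Local Open Scope classical_set_scope.
Local Open Scope ring_scope.

                                                                              
                                                                               
                                                                                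
                                                                               
                                                                               
                                                                             
                                                                               
                                                                              
                                                                                
                                                               

(** The output is a function of the noisy vector [- p + g], with [p] the stationary distribution, so
    it suffices to compare the laws of this vector for two adjacent datasets, with stationary
    distributions [p] and [q]. For independent Laplace noise of scale [lambda], the two laws differ
    by a factor of at most exp([norm1 (p - q) / lambda]), as in the Laplace mechanism
    ([joint_laplace_translate_le]).

    The l1 distance is controlled by perturbation of Markov chains. Changing one outcome moves each
    row of the transition matrix by at most 2/(dL) in l1 norm ([transition_mx_sensitivity]), and
    contraction by the ergodicity coefficient turns this into [norm1 (p - q) <= s]
    ([stationary_perturbation], [stationary_sensitivity]).

    Finally 8 sqrt(k log(m/delta)) >= 1 in the given range of parameters, so [lambda >= s / eps] and
    the factor is at most exp(eps). This proves the inequality without its additive term, and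
    [delta >= 0] is then added on the right. *)

(** * Uniqueness of measures on the line and on tuples *)

Lemma lebesgue_measure_translate (R : realType) (c : R) (A : set R) :
  measurable A ->
  pushforward lebesgue_measure
    (fun x : measurableTypeR R => x + c : measurableTypeR R) A =
  lebesgue_measure A.
Proof.
move=> mA; apply/esym/lebesgue_measure_unique => //=; first exact: measurable_funD.
move=> _ _ [[a b] _ <-].
rewrite /pushforward [X in _ = lebesgue_measure X](_ : _ = `]a - c, b - c]%classic).
  rewrite !lebesgue_measure_itv /= !lte_fin ltrD2r -!EFinB.
  by rewrite opprD opprK addrACA addNr addr0.
by apply/seteqP; split => x /=; rewrite !in_itv /= ltrBlDr lerBrDr.
Qed.

                                                                        
(** Boxes are closed under intersection and generate the product sigma-algebra, since a cylinder is
    a box whose other sides are full. Two measures agreeing on such a pi-system, one of them finite,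
    coincide. *)
Lemma tuple_measure_unique (R : realType) d (T : measurableType d) (n : nat)
    (mu nu : {measure set (n.-tuple T) -> \bar R}) :
  (mu [set: n.-tuple T] < +oo)%E ->
  (forall B : 'I_n -> set T, (forall i, measurable (B i)) ->
    mu [set t | forall i, B i (tnth t i)] =
    nu [set t | forall i, B i (tnth t i)]) ->
  forall A, measurable A -> mu A = nu A.
Proof.
move=> mufin munu.
pose G := [set A : set (n.-tuple T) | exists2 B : 'I_n -> set T,
  (forall i, measurable (B i)) & A = [set t | forall i, B i (tnth t i)]].
have mG : G `<=` measurable.
  move=> _ [B mB ->].
  rewrite (_ : [set t | _] = \bigcap_(i in [set: 'I_n]) ((@tnth n T)^~ i @^-1` B i)).
    apply: fin_bigcap_measurable => // i _.
    by rewrite -[X in measurable X]setTI; exact: measurable_tnth.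
  by apply/seteqP; split => [t tB i _|t tB i]; exact: tB.
have GT : G setT.
  exists (fun=> setT) => //.
  by apply/seteqP; split.
move=> A mA; apply: (g_sigma_algebra_measure_unique G mG (fun=> setT)) => //.
- by rewrite bigcup_const //; exists 0%N.
- move=> _ _ [B mB ->] [C mC ->]; exists (fun i => B i `&` C i).
    by move=> i; exact: measurableI.
  apply/seteqP; split => [t [tB tC] i|t tBC]; first by split.
  by split=> i; have [] := tBC i.
- by move=> _ [B mB ->]; exact: munu.
- apply: (smallest_sub _ _ mA); first exact: smallest_sigma_algebra.
  move=> X; rewrite -bigcup_seq /= => -[i _ [Y mY <-]].
  apply: sub_gen_smallest; exists (fun j => if j == i then Y else setT).
    by move=> j; case: ifP.
  apply/seteqP; split=> [t [_ /= tY] j|t tY]; first by case: eqP => [->|].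
  by split => //=; have := tY i; rewrite eqxx.
Qed.

(** * Joint laws of independent variables and of shifted Laplace noise *)

Section joint.
Context {R : realType} {disp : measure_display} {T : measurableType disp}.
Variable P : probability T R.

Definition joint {n : nat} (X : 'I_n -> {RV P >-> R}) (w : T) : n.-tuple R :=
  [tuple X i w | i < n].

Lemma measurable_joint n (X : 'I_n -> {RV P >-> R}) :
  measurable_fun setT (joint X).
Proof.
apply/measurable_fun_tnthP => i.
by rewrite (_ : _ \o _ = X i) //; apply/funext => w /=; rewrite tnth_mktuple.
Qed.

                                                                                  
                                                 
(** Coordinate [i] is read from a fresh real instead of from the sample point. The map does not
    involve [X i], so families that differ only at [i] share it. *)
Definition resample {n : nat} (X : 'I_n -> {RV P >-> R}) (i : 'I_n)
    (p : T * R) : n.-tuple R :=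
  [tuple if j == i then p.2 else X j p.1 | j < n].

Lemma measurable_resample n (X : 'I_n -> {RV P >-> R}) i :
  measurable_fun setT (resample X i).
Proof.
apply/measurable_fun_tnthP => j.
rewrite (_ : _ \o _ = if j == i then snd else X j \o fst); last first.
  by apply/funext => p /=; rewrite tnth_mktuple; case: ifP.
case: ifP => _; first exact: measurable_snd.
by apply: measurableT_comp.
Qed.

(** By independence, redrawing coordinate [i] from its own law leaves the joint law unchanged; it is
    enough to check this on boxes. *)
Lemma joint_law_resample n (X : 'I_n -> {RV P >-> R}) (i : 'I_n)
    (A : set (n.-tuple R)) :
  mutually_independent X -> measurable A ->
  P (joint X @^-1` A) =
  (P \x distribution P (X i))%E (resample X i @^-1` A).
Proof.
move=> indX mA.
rewrite -[LHS]/(pushforward P (joint X) A) -[RHS]/(pushforward _ (resample X i) A).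
apply: tuple_measure_unique mA => /=.
- exact: measurable_joint.
- exact: measurable_resample.
- by move=> ?; rewrite /pushforward preimage_setT probability_setT ltry.
move=> ? ? B mB; rewrite /pushforward.
pose E j := X j @^-1` B j.
have -> : joint X @^-1` [set t | forall i, B i (tnth t i)] =
    \bigcap_(j in [set` [set: 'I_n]%SET]) E j.
  apply/seteqP; split=> [w wB j _|w wB j]; first by have := wB j; rewrite tnth_mktuple.
  by rewrite tnth_mktuple; apply: wB; rewrite /= inE.
(* The preimage of a box is a rectangle, so its product measure factors. Independence is then used
   twice: for all the indices and for those other than [i]. *)
have -> : resample X i @^-1` [set t | forall i, B i (tnth t i)] =
    (\bigcap_(j in [set` (~: [set i])%SET]) E j) `*` B i.
  apply/seteqP; split=> [[w x] /= wB|[w x] [/= wB xB] j].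
    split=> [j|/=]; last by have := wB i; rewrite tnth_mktuple eqxx.
    by rewrite /= !inE => /negbTE ji; have := wB j; rewrite tnth_mktuple ji.
  by rewrite tnth_mktuple; case: eqVneq => [->//|ji]; apply: wB; rewrite /= !inE.
have mE j : measurable (E j) by rewrite -[E j]setTI; exact: measurable_funP.
rewrite product_measure1E //; last by apply: fin_bigcap_measurable.
rewrite indX // (bigD1 i) ?inE //= muleC; congr (_ * _)%E.
by rewrite indX //; apply: eq_bigl => j; rewrite !inE.
Qed.

(** Both joint laws are images of product measures under the same [resample] map, so the
    one-dimensional bound applies to each section and is integrated over the other factor. *)
Lemma joint_change_coordinate n (X Y : 'I_n -> {RV P >-> R}) (i : 'I_n) (K : R)
    (A : set (n.-tuple R)) :
  mutually_independent X -> mutually_independent Y ->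
  (forall j, j != i -> X j = Y j) -> 0 <= K ->
  (forall B, measurable B ->
    (distribution P (X i) B <= K%:E * distribution P (Y i) B)%E) ->
  measurable A ->
  (P (joint X @^-1` A) <= K%:E * P (joint Y @^-1` A))%E.
Proof.
move=> indX indY XY K0 XYi mA.
rewrite (joint_law_resample _ _ i _ indX mA) (joint_law_resample _ _ i _ indY mA).
have -> : resample X i = resample Y i.
  apply/funext => p; apply: eq_from_tnth => j; rewrite !tnth_mktuple.
  by case: eqVneq => // ji; rewrite XY.
set C := _ @^-1` A.
have mC : measurable C by rewrite -[C]setTI; exact: measurable_resample.
rewrite /product_measure1 -ge0_integralZl//; last first.
  exact: measurable_fun_xsection.
apply: ge0_le_integral => //.
- exact: measurable_fun_xsection.
- by apply: measurable_funeM; exact: measurable_fun_xsection.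
by move=> x _; apply: XYi; exact: measurable_xsection.
Qed.

Definition translate (X : {RV P >-> R}) (c : R) : {RV P >-> R} := X \+ cst c.

Lemma translate_independent n (X : 'I_n -> {RV P >-> R}) (c : 'I_n -> R) :
  mutually_independent X -> mutually_independent (fun i => translate (X i) (c i)).
Proof.
move=> indX J B mB.
apply: (indX J (fun i => (fun x => x + c i) @^-1` B i)) => i.
by rewrite -[X in measurable X]setTI; apply: measurable_funD.
Qed.

Lemma measurable_laplace_pdf (b : R) : measurable_fun setT (laplace_pdf b).
Proof.
apply: measurable_funM => //.
apply: measurableT_comp => //; apply: measurable_funM => //.
by apply: measurableT_comp => //; exact: measurableT_comp.
Qed.

Lemma laplace_pdf_ge0 (b x : R) : 0 < b -> 0 <= laplace_pdf b x.
Proof.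
by move=> b0; rewrite mulr_ge0 ?expR_ge0 // invr_ge0 mulr_ge0 // ltW.
Qed.

Lemma laplace_pdf_translate (b x t : R) : 0 < b ->
  laplace_pdf b x <= expR (`|t| / b) * laplace_pdf b (x + t).
Proof.
move=> b0; rewrite /laplace_pdf mulrCA -expRD.
apply: ler_wpM2l; first by rewrite invr_ge0 mulr_ge0 // ltW.
rewrite ler_expR -mulrDl ler_pM2r ?invr_gt0 //.
by rewrite lerNl opprD opprK addrC lerBlDr ler_normD.
Qed.

Lemma laplace_translateE (b c : R) (X : {RV P >-> R}) (B : set R) :
  0 < b -> laplace_distributed b X -> measurable B ->
  distribution P (translate X c) B =
  (\int[lebesgue_measure]_(x in B) (laplace_pdf b (x - c))%:E)%E.
Proof.
move=> b0 lapX mB.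
pose f (x : measurableTypeR R) : measurableTypeR R := x + c.
have mf : measurable_fun setT f by exact: measurable_funD.
transitivity (distribution P X (f @^-1` B)); first by [].
rewrite lapX; last by rewrite -[X in measurable X]setTI; exact: mf.
transitivity (\int[pushforward lebesgue_measure f]_(x in B) (laplace_pdf b (x - c))%:E)%E.
  rewrite ge0_integral_pushforward //.
  - by apply: eq_integral => x _ /=; rewrite addrK.
  - apply/measurable_EFinP; apply: measurable_funTS.
    apply: (measurableT_comp (measurable_laplace_pdf b)).
    exact: measurable_funD.
  - by move=> x _; rewrite lee_fin laplace_pdf_ge0.
by apply: eq_measure_integral => // A mA _; exact: lebesgue_measure_translate.
Qed.

Lemma laplace_translate_le (b c c' : R) (X : {RV P >-> R}) (B : set R) :
  0 < b -> laplace_distributed b X -> measurable B ->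
  (distribution P (translate X c) B <=
   (expR (`|c - c'| / b))%:E * distribution P (translate X c') B)%E.
Proof.
move=> b0 lapX mB; rewrite !(laplace_translateE b) //.
have mpdf z : measurable_fun B (fun x => (laplace_pdf b (x - z))%:E).
  apply/measurable_EFinP; apply: measurable_funTS.
  apply: (measurableT_comp (measurable_laplace_pdf b)).
  exact: measurable_funD.
rewrite -ge0_integralZl //; last 2 first.
- exact: mpdf.
- by move=> x _; rewrite lee_fin laplace_pdf_ge0.
apply: ge0_le_integral => //.
- by move=> x _; rewrite lee_fin laplace_pdf_ge0.
- exact: mpdf.
- by apply: measurable_funeM; exact: mpdf.
move=> x _; rewrite -EFinM lee_fin.
have -> : x - c' = (x - c) + (c - c') by rewrite addrA subrK.
exact: laplace_pdf_translate.
Qed.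

(** A hybrid argument: the shifts are changed from [c] to [c'] one coordinate at a time, and the
    one-dimensional factors multiply to the exponential of the l1 distance. *)
Lemma joint_laplace_translate_le (n : nat) (b : R) (X : 'I_n -> {RV P >-> R})
    (c c' : 'I_n -> R) (A : set (n.-tuple R)) :
  0 < b -> mutually_independent X -> (forall i, laplace_distributed b (X i)) ->
  measurable A ->
  (P (joint (fun i => translate (X i) (c i)) @^-1` A) <=
   (expR ((\sum_i `|c i - c' i|) / b))%:E *
   P (joint (fun i => translate (X i) (c' i)) @^-1` A))%E.
Proof.
move=> b0 indX lapX mA.
have: forall j, j \notin index_enum 'I_n -> c j = c' j.
  by move=> j; rewrite mem_index_enum.
                                                              
(* Induction on the list of coordinates still to be changed, for all [c] that agree with [c'] off
   this list. The hybrid [c''] below has coordinate [i] already changed. *)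
elim: (index_enum _) (index_enum_uniq 'I_n) c => [|i s IH] /=.
  move=> _ c cc'; rewrite big_nil mul0r expR0 mul1e.
  rewrite (_ : (fun i => _ (c i)) = (fun i => translate (X i) (c' i))) //.
  by apply/funext => j; rewrite cc'.
move=> /andP[iNs us] c cc'; rewrite big_cons.
pose c'' j := if j == i then c' i else c j.
have -> : \sum_(j <- s) `|c j - c' j| = \sum_(j <- s) `|c'' j - c' j|.
  apply: eq_big_seq => j js; rewrite /c''; case: eqVneq => // ji.
  by rewrite -ji js in iNs.
rewrite mulrDl expRD EFinM -muleA.
apply: (@le_trans _ _ ((expR (`|c i - c' i| / b))%:E *
    P (joint (fun j => translate (X j) (c'' j)) @^-1` A))%E).
  apply: (joint_change_coordinate _ _ _ i) => //; try exact: translate_independent.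
  - by move=> j /negbTE ji; rewrite /c'' ji.
  - by move=> B mB; rewrite /c'' eqxx; exact: laplace_translate_le.
rewrite lee_pmul2l ?lte_fin ?expR_gt0 //.
apply: IH => // j js; rewrite /c''; case: eqVneq => [->//|ji].
by apply: cc'; rewrite inE negb_or ji.
Qed.

End joint.

(** * Measurability of the selection, and a logarithmic inequality *)

Lemma measurable_k_smallest (R : realType) (m k : nat) (S : set {set 'I_m}) :
  measurable [set t : m.-tuple R | S (k_smallest k (tnth t))].
Proof.
                                                                               
(* Sorting sees a tuple only through its pairwise comparisons. There are finitely many comparison
   patterns, so the event is a finite union of measurable pattern classes. *)
pose pat (t : m.-tuple R) := [ffun p : 'I_m * 'I_m => tnth t p.1 <= tnth t p.2].
pose F (c : {ffun 'I_m * 'I_m -> bool}) : {set 'I_m} :=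
  [set:: take k (sort (fun i j => c (i, j)) (enum 'I_m))]%SET.
have kF t : k_smallest k (tnth t) = F (pat t).
  rewrite /k_smallest /F.
  suff -> : (fun i j => tnth t i <= tnth t j) = (fun i j => pat t (i, j)) by [].
  by apply/funext => i; apply/funext => j; rewrite /pat ffunE.
have mle (i j : 'I_m) : measurable [set t : m.-tuple R | tnth t i <= tnth t j].
  rewrite -[X in measurable X]setTI.
  by apply: measurable_fun_le => //; exact: measurable_tnth.
have mpat c : measurable (pat @^-1` [set c]).
  rewrite (_ : _ @^-1` _ = \bigcap_(p in [set: 'I_m * 'I_m])
      [set t | (tnth t p.1 <= tnth t p.2) = c p]).
    apply: fin_bigcap_measurable => // -[i j] _ /=; case: (c _); first exact: mle.
    rewrite (_ : mkset _ = ~` [set t | tnth t i <= tnth t j]); last first.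
      by apply/seteqP; split => t /=; [move=> ->|move/negP/negbTE].
    by apply: measurableC; exact: mle.
  apply/seteqP; split => [t <- p _|t tc] /=; first by rewrite /pat ffunE.
  by apply/ffunP => p; rewrite ffunE tc.
rewrite (_ : mkset _ = \bigcup_(c in [set c | S (F c)]) (pat @^-1` [set c])).
  by apply: fin_bigcup_measurable => // c _; exact: mpat.
apply/seteqP; split => [t St|t [c Sc tc]] /=; last by rewrite kF tc.
by exists (pat t) => //=; rewrite -kF.
Qed.

Lemma ln_ge_1BV (R : realType) (x : R) : 0 < x -> 1 - x^-1 <= ln x.
Proof.
move=> x0; have /le_ln1Dx : -1 < x^-1 - 1 by rewrite ltrBrDr addNr invr_gt0.
by rewrite addrC subrK lnV ?posrE // lerNl opprB.
Qed.

(** * The l1 norm and perturbation of stationary distributions *)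

Section norm1.
Context {R : realType} {n : nat}.
Implicit Types (v : 'rV[R]_n) (A : 'M[R]_n).

Lemma norm1_ge0 v : 0 <= norm1 v.
Proof. exact: sumr_ge0. Qed.

Lemma norm1D u v : norm1 (u + v) <= norm1 u + norm1 v.
Proof.
rewrite /norm1 -big_split /=; apply: ler_sum => i _.
by rewrite mxE ler_normD.
Qed.

Lemma norm1Z (a : R) v : norm1 (a *: v) = `|a| * norm1 v.
Proof. by rewrite /norm1 mulr_sumr; apply: eq_bigr => i _; rewrite mxE normrM. Qed.

Lemma norm1_eq0 v : norm1 v = 0 -> v = 0.
Proof.
move=> v0; apply/rowP => i; rewrite mxE; apply/eqP; rewrite -normr_eq0 eq_le normr_ge0 andbT.
by rewrite -v0 /norm1 (bigD1 i) //= lerDl sumr_ge0.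
Qed.

Lemma norm1_mulmx_le v A (C : R) : (forall i, \sum_j `|A i j| <= C) ->
  norm1 (v *m A) <= C * norm1 v.
Proof.
move=> AC; apply: (@le_trans _ _ (\sum_j \sum_i `|v 0 i| * `|A i j|)).
  apply: ler_sum => j _; rewrite mxE.
  apply: le_trans (ler_norm_sum _ _ _) _.
  by apply: ler_sum => i _; rewrite normrM.
rewrite exchange_big /norm1 mulr_sumr /=; apply: ler_sum => i _.
by rewrite -mulr_sumr mulrC ler_wpM2r.
Qed.

Lemma norm1_mulmx_ergodicity v A : stochastic_mx A -> \sum_i v 0 i = 0 ->
  norm1 (v *m A) <= ergodicity_coef A * norm1 v.
Proof.
move=> [A0 A1] sv; have [/eqP v0|vn0] := eqVneq (norm1 v) 0.
  have -> : v = 0 by apply: norm1_eq0; apply/eqP.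
  by rewrite mul0mx /norm1 !big1 ?mulr0// => i _; rewrite mxE normr0.
rewrite -ler_pdivrMr ?lt0r ?vn0 ?norm1_ge0 //.
have nv : norm1 v * (norm1 v)^-1 = 1 by rewrite divff.
apply: ub_le_sup.
  (* The [sup] dominates its elements only if the set is bounded; the bound 1 comes from the unit
     row sums of a stochastic matrix. *)
  exists 1 => _ [u [u1 _] <-]; rewrite -[leRHS](mulr1 1) -[X in _ <= _ * X]u1.
  apply: norm1_mulmx_le => i; rewrite -[X in _ <= X](A1 i).
  by apply: ler_sum => j _; rewrite ger0_norm.
exists ((norm1 v)^-1 *: v); last first.
  by rewrite -scalemxAl norm1Z ger0_norm ?invr_ge0 ?norm1_ge0// mulrC.
split; first by rewrite norm1Z ger0_norm ?invr_ge0 ?norm1_ge0// mulrC.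
under eq_bigr do rewrite mxE.
by rewrite -mulr_sumr sv mulr0.
Qed.

(** From pA = p and qB = q follows p - q = (p - q)A + q(A - B). The entries of p - q sum to 0, so
    the first term has norm at most rho times that of p - q; the second has norm at most C because q
    has norm 1. Solving for the norm of p - q gives the bound. *)
Lemma stationary_perturbation A B (p q : 'rV[R]_n) (rho C : R) :
  stochastic_mx A -> ergodicity_coef A <= rho -> rho < 1 ->
  (forall i, \sum_j `|(A - B) i j| <= C) ->
  stationary A p -> stationary B q -> norm1 (p - q) <= C / (1 - rho).
Proof.
move=> sA Arho rho1 ABC [_ p1 pA] [q0 q1 qB].
rewrite ler_pdivlMr ?subr_gt0 // mulrBr mulr1 lerBlDr.
have {1}-> : p - q = (p - q) *m A + q *m (A - B).
  by rewrite mulmxBl mulmxBr pA qB addrA subrK.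
rewrite addrC; apply: le_trans (norm1D _ _) _; apply: lerD.
  apply: le_trans (norm1_mulmx_le _ _ _ ABC) _.
  suff -> : norm1 q = 1 by rewrite mulr1.
  by rewrite -q1; apply: eq_bigr => i _; rewrite ger0_norm.
rewrite mulrC.
apply: le_trans (ler_wpM2r (norm1_ge0 _) Arho).
apply: norm1_mulmx_ergodicity => //.
under eq_bigr do rewrite !mxE.
by rewrite sumrB p1 q1 subrr.
Qed.

End norm1.

(** * Sensitivity of the transition matrix and of its stationary distribution *)

(** In each row at most one off-diagonal entry changes, by at most 1/(dL). The diagonal entry
    compensates for it, whence the factor 2. *)
Lemma transition_mx_sensitivity (R : realType) (m L : nat) (d : R)
    (D D' : comparison_graph m L) (a : 'I_m) :
  0 < d -> adjacent_data D D' ->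
  \sum_b `|(transition_mx d D - transition_mx d D') a b| <= 2 / (d * L%:R).
Proof.
move=> d0 [eDD' [l [i [j [eij _ outDD']]]]].
pose r b : R := mean_outcome D a b - mean_outcome D' a b.
have d'0 : 0 <= d^-1 by rewrite invr_ge0 ltW.
have rE : \sum_(b | edge D a b) `|r b| <= L%:R^-1.
                                                                               
  (* The only possible neighbour of [a] across a changed edge. When [a] is neither [i] nor [j]
     nothing changes in the row, and the value [i] is harmless. *)
  pose mate := if a == i then j else i.
  have r0 b : edge D a b -> b != mate -> r b = 0.
    move=> eab bm; rewrite /r /mean_outcome -mulrBr -sumrB big1 ?mulr0 // => l' _.
    rewrite outDD' ?subrr //; apply/negP => /eqP[_ E].
    have : a \in [set i; j]%SET by rewrite -E set21.
    have : b \in [set i; j]%SET by rewrite -E set22.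
    have ab : a != b by apply: contraTneq eab => ->; rewrite edge_irr.
    rewrite !inE; move: bm; rewrite /mate; have [<-|ai] := eqVneq a i => bm.
      by rewrite (negbTE bm) orbF eq_sym (negbTE ab).
    by rewrite (negbTE bm) /= => /eqP bj /eqP aj; rewrite bj aj eqxx in ab.
  have rmate : edge D a mate -> `|r mate| <= L%:R^-1.
    move=> eam; rewrite /r /mean_outcome -mulrBr normrM ger0_norm ?invr_ge0 ?ler0n //.
    rewrite -[leRHS]mulr1 ler_wpM2l ?invr_ge0 ?ler0n //.
    rewrite -sumrB (bigD1 l) //= big1 ?addr0.
      by case: (outcome _ _ _ _); case: (outcome _ _ _ _);
        rewrite ?subrr ?subr0 ?sub0r ?normrN ?normr1 ?normr0.
    move=> l' l'l; rewrite outDD' ?subrr //.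
    by apply: contraNneq l'l => -[->].
  have [eam|neam] := boolP (edge D a mate); last first.
    rewrite big1 ?invr_ge0 ?ler0n // => b eab; rewrite r0 ?normr0 //.
    by apply: contraNneq neam => <-.
  rewrite (bigD1 mate) //= big1 ?addr0 ?rmate // => b /andP[eab bm].
  by rewrite r0 ?normr0.
have edgeE (F : 'I_m -> R) : \sum_(b | edge D' a b) F b = \sum_(b | edge D a b) F b.
  by apply: eq_bigl => b; rewrite eDD'.
have offdiag : \sum_(b | b != a) `|(transition_mx d D - transition_mx d D') a b| =
    d^-1 * \sum_(b | edge D a b) `|r b|.
  rewrite mulr_sumr [RHS]big_mkcond [LHS]big_mkcond /=; apply: eq_bigr => b _.
  rewrite !mxE -eDD' eq_sym; have [<-|ab] := eqVneq; first by rewrite edge_irr.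
  case: ifP => _; last by rewrite subrr normr0.
  by rewrite -mulrBr normrM ger0_norm.
have diag : `|(transition_mx d D - transition_mx d D') a a| <=
    d^-1 * \sum_(b | edge D a b) `|r b|.
  rewrite !mxE eqxx edgeE opprB addrC addrA subrK -mulrBr -sumrB normrM ger0_norm //.
  rewrite ler_wpM2l //; apply: le_trans (ler_norm_sum _ _ _) _.
  by apply: ler_sum => b _; rewrite distrC.
rewrite (bigD1 a) //= offdiag.
apply: le_trans (lerD diag (lexx _)) _.
by rewrite -mulr2n -[leLHS]mulr_natl invfM ler_wpM2l // ler_wpM2l.
Qed.

Lemma stationary_sensitivity (R : realType) (m L : nat) (d rho : R)
    (D D' : comparison_graph m L) :
  0 < d -> rho < 1 -> rho_constrained d rho D -> rho_constrained d rho D' ->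
  adjacent_data D D' ->
  norm1 (stationary_distribution (transition_mx d D) -
         stationary_distribution (transition_mx d D')) <=
  2 / (d * L%:R * (1 - rho)).
Proof.
move=> d0 rho1 [sA [p [statp _]] Arho] [_ [q [statq _]] _] DD'.
have -> : 2 / (d * L%:R * (1 - rho)) = 2 / (d * L%:R) / (1 - rho).
  by rewrite invfM mulrA.
apply: (stationary_perturbation _ (transition_mx d D') _ _ _ _ sA Arho rho1).
- by move=> i; exact: transition_mx_sensitivity.
- exact: xgetI statp.
- exact: xgetI statq.
Qed.

(** * Privacy of the method *)

Theorem theorem3p5 (R : realType) (m L k : nat) (d rho eps delta lambda : R)
    (disp : measure_display) (T : measurableType disp) (P : probability T R)
    (g : 'I_m -> {RV P >-> R}) :
  (0 < L)%N -> (1 <= k <= m)%N -> 0 < d -> rho < 1 ->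
  0 < eps <= 2 / 10 -> 0 < delta <= 5 / 100 -> 0 < lambda ->
  mutually_independent g ->
  (forall i, laplace_distributed lambda (g i)) ->
  let s := 2 / (d * L%:R * (1 - rho)) in
  8 * s * Num.sqrt (k%:R * ln (m%:R / delta)) / eps <= lambda ->
  differentially_private P (rho_constrained d rho) (@adjacent_data m L)
    (oneshot_spectral d k (fun i w => g i w)) eps delta.
Proof.
move=> L0 /andP[k1 km] d0 rho1 /andP[eps0 _] /andP[delta0 delta1] lambda0 indg lapg s.
move=> lambda_ge D D' admD admD' DD' S.
pose p := stationary_distribution (transition_mx d D).
pose q := stationary_distribution (transition_mx d D').
pose A := [set t : m.-tuple R | S (k_smallest k (tnth t))].
have mA : measurable A by exact: measurable_k_smallest.
(* The event is rewritten so that the data enter only through the shifts of the noise; the set [A]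
   is the same for both datasets. *)
have eventE E : oneshot_spectral d k (fun i w => g i w) E @^-1` S =
    joint P (fun i => translate P (g i)
      (- stationary_distribution (transition_mx d E) 0 i)) @^-1` A.
  apply/seteqP; split => w; rewrite /A /oneshot_spectral /=;
    rewrite (_ : tnth _ = fun i => - stationary_distribution (transition_mx d E) 0 i + g i w) //;
    by apply/funext => i; rewrite tnth_mktuple /= addrC.
rewrite !eventE.
have delta_ge0 : (0 <= delta%:E)%E by rewrite lee_fin ltW.
apply: le_trans (leeDl _ delta_ge0).
have := joint_laplace_translate_le P _ _ _ (fun i => - p 0 i)
  (fun i => - q 0 i) _ lambda0 indg lapg mA.
move/le_trans; apply.
apply: lee_wpmul2r => //.
rewrite lee_fin ler_expR ler_pdivrMr //.
have -> : \sum_i `|- p 0 i - - q 0 i| = norm1 (p - q).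
  by apply: eq_bigr => i _; rewrite !mxE -opprD normrN.
apply: le_trans (stationary_sensitivity _ _ _ _ _ _ _ d0 rho1 admD admD' DD') _.
rewrite -/s mulrC -ler_pdivrMr //; apply: le_trans lambda_ge.
rewrite ler_pM2r ?invr_gt0 //.
have s0 : 0 <= s by rewrite ltW // divr_gt0 // !mulr_gt0 ?subr_gt0 ?ltr0n.
(* With [s] cancelled, it remains to show 8 sqrt(k log(m/delta)) >= 1. *)
rewrite mulrAC -[leLHS]mul1r ler_wpM2r //.
have m1 : (1 : R) <= m%:R by rewrite ler1n (leq_trans k1).
have x20 : 20 <= m%:R / delta by rewrite ler_pdivlMr //; lra.
have x0 : 0 < m%:R / delta by apply: lt_le_trans x20; rewrite ltr0n.
(* The target 1/64 is the square of 1/8. Since m/delta >= 20, the logarithm is at least 1 - 1/20,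
   well above it. *)
have ln_ge : 64%:R^-1 <= ln (m%:R / delta).
  apply: le_trans (ln_ge_1BV _ _ x0).
  have : (m%:R / delta)^-1 <= 20^-1 by rewrite lef_pV2 ?posrE // ltr0n.
  lra.
have kln : (8^-1) ^+ 2 <= k%:R * ln (m%:R / delta) :> R.
  have k1R : (1 : R) <= k%:R by rewrite ler1n.
  apply: (@le_trans _ _ (1 * 64%:R^-1)); first lra.
  by apply: ler_pM => //; rewrite invr_ge0 ler0n.
have : 8^-1 <= Num.sqrt (k%:R * ln (m%:R / delta)).
  by rewrite -[leLHS]ger0_norm ?invr_ge0 ?ler0n // -sqrtr_sqr ler_wsqrtr.
lra.
Qed.
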